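(* Let $G=(V,E)$ be a semi-circular cubic ($3$-regular) simple graph with $n=|V|$ vertices, and let $n_1=|V_1|$ and $n_0=|V_0|$ be the number of vertices of $G$ lying in the closed disk bounded by the first circle $O_1$ and in the interior of that disk, respectively. If $G$ has no $3$-cycles and no $4$-cycles, then the number $\operatorname{perfmat} G$ of perfect matchings of $G$ satisfies $$\operatorname{perfmat} G\le 20^{\frac{n-n_1}{12}}\,3^{\frac{n_1}{4}}\quad\text{if } n_0>0,$$ $$\operatorname{perfmat} G\le 20^{\frac n{12}}\quad\text{if } G \text{ is circular, i.e. } n_0=0.$$
   Context: A connected planar graph $G=(V,E)$ is semi-circular if it can be drawn in the plane as follows. There are $k\ge1$ circles $O_1,\dots,O_k$ centered at the origin, of radii $0<r_1<\dots<r_k$. On the circle $O_j$ there are $m_j\ge3$ vertices, forming a set $U_j\subset V$, and the subgraph $G(U_j)$ of $G$ induced on $U_j$ is the cycle $C_{m_j}$ whose edges are the arcs of $O_j$ between consecutive vertices. For $i=1,\dots,k-1$ some vertices of $U_i$ are joined to some vertices of $U_{i+1}$ by edges lying in the annulus $r_i\le\sqrt{x^2+y^2}\le r_{i+1}$ which do not intersect in the interior of the annulus (at least one such edge exists for each $i$, as $G$ is connected). The remaining vertices form a set $V_0$ lying in the open disk of radius $r_1$ about the origin, and the subgraph $G(U_1\cup V_0)$ induced on $U_1\cup V_0$ is a connected planar graph whose vertices and edges lie in the closed disk of radius $r_1$. $G$ has no other vertices or edges. Set $V_i=V_0\cup U_1\cup\dots\cup U_i$, so $V_k=V$. $G$ (with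 such a drawing) is circular if $V_0=\emptyset$. *)

(* Defs.v *)
From HB Require Import structures.
From mathcomp Require Import all_boot all_order all_algebra.
From mathcomp Require Import all_classical all_reals all_analysis.

Set Implicit Arguments.
Unset Strict Implicit.
Unset Printing Implicit Defensive.

Import Order.TTheory GRing.Theory Num.Theory.
Import numFieldNormedType.Exports.

Local Open Scope ring_scope.

(* A finite simple graph is a symmetric irreflexive relation on a finType.    *)
Section Graphs.
Variables (V : finType) (e : rel V).

Definition edges : {set {set V}} :=
  [set f : {set V} | [exists x, exists y, e x y && (f == [set x; y])]]%SET.

Definition perfect_matching (M : {set {set V}}) : bool :=
  (M \subset edges) && [forall v, #|[set f in M | v \in f]%SET| == 1%N].

Definition perfmat : nat :=
  #|[set M : {set {set V}} | perfect_matching M]%SET|.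

Definition cubic : Prop := forall v, #|[set w | e v w]%SET| = 3%N.

(* For l >= 3 the duplicate-free cycles of size l are the l-cycles of the     *)
(* graph; chords are allowed.                                                 *)
Definition no_cycle (l : nat) : Prop :=
  forall c : seq V, ucycle e c -> size c <> l.

Definition induced (S : {set V}) : rel V :=
  [rel x y | [&& x \in S, y \in S & e x y]].

Definition connected_on (S : {set V}) : Prop :=
  {in S &, forall x y, connect (induced S) x y}.

End Graphs.

Local Open Scope classical_set_scope.

Section Plane.
Variable R : realType.

(* The norm that the library puts on R * R is the max norm.                   *)
Definition enorm (p : R * R) : R := Num.sqrt (p.1 ^+ 2 + p.2 ^+ 2).

Definition circle_pt (r t : R) : R * R := (r * cos t, r * sin t).

Definition circle_arc (r a b : R) : set (R * R) := circle_pt r @` `[a, b].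

Definition simple_arc (C : set (R * R)) (p q : R * R) : Prop :=
  exists g : R -> R * R,
    [/\ {within `[0, 1], continuous g},
        {in `[0, 1]%R &, injective g},
        g 0 = p, g 1 = q & g @` `[0, 1] = C].

End Plane.

Section Drawings.
Variables (R : realType) (V : finType) (e : rel V).

(* curve x y is only meaningful when e x y holds.                             *)
Record plane_drawing := PlaneDrawing {
  pos : V -> R * R;
  curve : V -> V -> set (R * R);
  pos_inj : injective pos;
  curve_arc : forall x y, e x y -> simple_arc (curve x y) (pos x) (pos y);
  curve_sym : forall x y, e x y -> curve y x = curve x y;
  curve_vertex : forall x y v, e x y -> curve x y (pos v) -> v \in [set x; y]%SET;
  curve_cross : forall x y z w, e x y -> e z w ->
    [set x; y]%SET <> [set z; w]%SET ->
    forall p, curve x y p -> curve z w p ->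
    exists2 v, v \in ([set x; y] :&: [set z; w])%SET & p = pos v
}.

(* The circle O_i has radius r i for 1 <= i <= k; the other values of r are   *)
(* irrelevant.                                                                *)
Variables (D : plane_drawing) (k : nat) (r : nat -> R).

Definition circle_vertices (i : nat) : {set V} :=
  [set v | enorm (pos D v) == r i]%SET.

Definition inner_vertices : {set V} := [set v | enorm (pos D v) < r 1%N]%SET.

Definition disk_vertices : {set V} :=
  (inner_vertices :|: circle_vertices 1)%SET.

(* The vertices on O_i are u 0, ..., u (m - 1) at increasing angles th 0, ...,*)
(* th (m - 1); the index m closes the turn.                                   *)
Definition circle_is_cycle (i : nat) : Prop :=
  exists m (u : nat -> V) (th : nat -> R),
    [/\ [/\ (3 <= m)%N, u m = u 0%N & th m = th 0%N + 2 * pi],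
        (forall j, (j < m)%N -> th j < th j.+1),
        (forall j, (j < m)%N -> pos D (u j) = circle_pt (r i) (th j)),
        (forall v, v \in circle_vertices i <-> exists2 j, (j < m)%N & v = u j) &
        {in circle_vertices i &, forall x y,
           e x y <->
           exists2 j, (j < m)%N & [set x; y]%SET = [set u j; u j.+1]%SET} /\
        (forall j, (j < m)%N ->
           curve D (u j) (u j.+1) = circle_arc (r i) (th j) (th j.+1))].

Record semicircular : Prop := SemiCircular {
  sc_connected : connected_on e [set: V]%SET;
  sc_k : (1 <= k)%N;
  sc_r1 : 0 < r 1%N;
  sc_r : forall i, (1 <= i < k)%N -> r i < r i.+1;
  sc_vertices : forall v, v \in inner_vertices \/
    exists2 i, (1 <= i <= k)%N & v \in circle_vertices i;
  sc_cycles : forall i, (1 <= i <= k)%N -> circle_is_cycle i;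
  sc_annulus : forall i x y, (1 <= i < k)%N ->
    x \in circle_vertices i -> y \in circle_vertices i.+1 -> e x y ->
    forall p, curve D x y p -> r i <= enorm p <= r i.+1;
  sc_joined : forall i, (1 <= i < k)%N ->
    exists x y, [/\ x \in circle_vertices i, y \in circle_vertices i.+1 & e x y];
  sc_disk_connected : connected_on e disk_vertices;
  sc_disk : {in disk_vertices &, forall x y, e x y ->
    forall p, curve D x y p -> enorm p <= r 1%N};
  sc_edges : forall x y, e x y ->
    [\/ x \in disk_vertices /\ y \in disk_vertices,
        exists2 i, (1 <= i <= k)%N &
          x \in circle_vertices i /\ y \in circle_vertices i |
        exists2 i, (1 <= i < k)%N &
          (x \in circle_vertices i /\ y \in circle_vertices i.+1) \/
          (y \in circle_vertices i /\ x \in circle_vertices i.+1)]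
}.

Definition circular : Prop := semicircular /\ inner_vertices = finset.set0.

End Drawings.

(* Main.v *)
(**
If [P] is the set of permutations [s] with [v] adjacent
to [s v] for all [v], then [perfmat ^ 2 <= #|P|], and Radhakrishnan's proof of
Bregman's theorem gives [#|P| ^ 30 <= (3 ^ 9 * 2 ^ 7) ^ n]: reveal the values of
[s] in a random order of the vertices. Let [y1], [y2] be the vertices that [s]
sends to the neighbours of [v] other than [s v], and [z1], [z2] the neighbours
of [s v] other than [v]. If [z1] and [z2] come before [v], then [s v] is forced;
in any case it has at most one option more than there are [y]'s after [v].
Without 4-cycles the five vertices are distinct, so that in a random order
there are at most 3, 2, 1 options with probability 9/30, 7/30, 14/30. Finally
[3 ^ 9 * 2 ^ 7 <= 20 ^ 5], which gives the bound for circular graphs, and the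
other one follows from [20 ^ (1/12) <= 3 ^ (1/4)].
*)
Require Import Defs.
From mathcomp Require Import all_boot all_order all_algebra all_fingroup.
From mathcomp Require Import all_classical all_reals all_analysis.
From mathcomp Require Import zify lra.
Import Order.TTheory GRing.Theory Num.Theory.

Set Implicit Arguments.
Unset Strict Implicit.
Unset Printing Implicit Defensive.

(** * Counting functions by revealing their values one at a time *)

Section SequentialCounting.
Variables (V W : finType) (ord : V -> nat) (F : {set {ffun V -> W}}).

Definition agree_below t (f : {ffun V -> W}) : {set {ffun V -> W}} :=
  [set g in F | [forall u, (ord u < t) ==> (g u == f u)]].

Definition options v (f : {ffun V -> W}) : {set W} :=
  [set (g : {ffun V -> W}) v | g in agree_below (ord v) f].

Lemma agree_belowP t (f g : {ffun V -> W}) :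
  reflect (g \in F /\ forall u, ord u < t -> g u = f u) (g \in agree_below t f).
Proof.
rewrite inE; apply: (iffP andP) => -[gF gf]; split=> //.
  by move=> u ut; apply/eqP; move/forallP/(_ u)/implyP: gf; apply.
by apply/forallP => u; apply/implyP => /gf ->.
Qed.

Lemma agree_below_eq t (f g : {ffun V -> W}) : g \in agree_below t f ->
  agree_below t g = agree_below t f.
Proof.
case/agree_belowP=> _ gf; apply/setP => h.
by apply/agree_belowP/agree_belowP => -[hF hg]; split=> // u ut;
  rewrite hg // gf.
Qed.

Hypothesis ord_inj : injective ord.

(* The product is the probability of producing f when each f v is drawn      *)
(* uniformly from its options, in the order given by ord.                     *)
Lemma sum_prod_options_le1 :
  (\sum_(f in F) \prod_v (#|options v f|%:R^-1 : rat) <= 1)%R.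
Proof.
pose w t (f : {ffun V -> W}) :=
  (\prod_(v | (t <= ord v)%N) (#|options v f|%:R^-1 : rat))%R.
(* Once the values at positions below [t] are fixed to those of [f], the conditional probabilities
   of the completions add up to at most 1; [d] bounds the number of positions left. *)
suff main d t f : (forall v, ord v < t + d) ->
    (\sum_(g in agree_below t f) w t g <= 1)%R.
  have [->|[f fF]] := set_0Vmem F; first by rewrite big_set0.
  have := @main (\max_v ord v).+1 0 f.
  have -> : agree_below 0 f = F.
    by apply/setP => g; apply/agree_belowP/idP => [[]|].
  rewrite (eq_bigr (fun f => \prod_v (#|options v f|%:R^-1 : rat))%R); last first.
    by move=> g _; apply: eq_bigl => v; rewrite leq0n.
  by apply=> v; rewrite add0n ltnS leq_bigmax.
elim: d t f => [|d IHd] t f ltd.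
  rewrite (eq_bigr (fun=> 1%R)); last first.
    by move=> g _; apply: big_pred0 => v; rewrite leqNgt -[t]addn0 ltd.
  rewrite sumr_const -[leRHS]/(1%:R)%R ler_nat.
  apply/card_le1P => g /agree_belowP[gF gf] h.
  rewrite [RHS]inE; apply/idP/eqP => [/agree_belowP[_ hf]|->]; last first.
    by apply/agree_belowP; split.
  by apply/ffunP => v; rewrite gf ?hf // -[t]addn0 ltd.
have ltd' v : ord v < t.+1 + d by rewrite addSnnS.
have [v /eqP tv|no_t] := pickP (fun v => ord v == t); last first.
  have wE g : w t g = w t.+1 g.
    by apply: eq_bigl => v; rewrite [in LHS]leq_eqVlt eq_sym no_t.
  rewrite (eq_bigr (w t.+1)) => [|g _]; last exact: wE.
  have -> : agree_below t f = agree_below t.+1 f; last exact: IHd.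
  apply/setP => g; apply/agree_belowP/agree_belowP => -[gF gf]; split=> // u ut;
    apply: gf; last exact: leqW.
  by move: ut; rewrite ltnS leq_eqVlt no_t.
have optE g : g \in agree_below t f -> options v g = options v f.
  by move=> gf; rewrite /options tv (agree_below_eq gf).
have wE g : g \in agree_below t f -> w t g = (#|options v f|%:R^-1 * w t.+1 g)%R.
  move=> gf; rewrite /w (bigD1 v) ?tv //= (optE _ gf); congr (_ * _)%R.
  apply: eq_bigl => u; rewrite ltn_neqAle andbC; congr (_ && _).
  by rewrite -tv (inj_eq ord_inj) eq_sym.
rewrite (eq_bigr _ wE) -mulr_sumr.
rewrite (partition_big_imset (fun g : {ffun V -> W} => g v)) /=.
have -> : [set (g : {ffun V -> W}) v | g in agree_below t f] = options v f.
  by rewrite /options tv.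
(* If no member of [F] extends the revealed values, the default [0^-1 = 0] makes the sum vanish. *)
have [k0|k_gt0] := posnP #|options v f|; first by rewrite k0 invr0 mul0r ler01.
rewrite mulrC ler_pdivrMr ?ltr0n // mul1r -[leRHS]sumr_const.
apply: ler_sum => a; rewrite /options tv => /imsetP[g gf ->].
apply: le_trans (IHd t.+1 g ltd').
rewrite le_eqVlt; apply/orP; left; apply/eqP/eq_bigl => h.
have /agree_belowP[_ gfu] := gf.
apply/andP/agree_belowP => [[/agree_belowP[hF hf] /eqP hg]|[hF hg]].
  split=> // u; rewrite ltnS leq_eqVlt => /orP[|ut].
    by rewrite -tv (inj_eq ord_inj) => /eqP ->.
  by rewrite hf ?gfu.
split; last by rewrite hg ?tv.
by apply/agree_belowP; split=> // u ut; rewrite hg ?gfu // leqW.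
Qed.

(** By AM-GM the geometric mean of the probabilities in [sum_prod_options_le1] is at most
    [1 / #|F|]; inverting gives the bound. This takes the place of an entropy argument. *)
Lemma card_le_prod_options :
  #|F| ^ #|F| <= \prod_(f in F) \prod_v #|options v f|.
Proof.
have [F0|F_gt0] := posnP #|F|; first by rewrite (cards0_eq F0) cards0 big_set0.
have opt_gt0 f v : f \in F -> 0 < #|options v f|.
  move=> fF; apply/card_gt0P; exists (f v); apply: imset_f.
  by apply/agree_belowP; split.
have prod_gt0 : 0 < \prod_(f in F) \prod_v #|options v f|.
  by apply: prodn_cond_gt0 => f fF; apply: prodn_gt0 => v; apply: opt_gt0.
have := @leif_AGM rat _ (mem F) (fun f => \prod_v (#|options v f|%:R^-1))%R.
case=> [f _|+ _]; first by apply: prodr_ge0 => v _; rewrite invr_ge0.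
rewrite (eq_bigr (fun f => (\prod_v #|options v f|)%:R^-1)%R); last first.
  by move=> f _; rewrite natr_prod prodfV.
rewrite prodfV -natr_prod => le_prod.
rewrite -(@ler_nat rat) natrX -[leLHS]invrK -exprVn invf_ple ?posrE
  ?exprn_gt0 ?invr_gt0 ?ltr0n //.
apply: le_trans le_prod _.
apply: lerXn2r; rewrite ?nnegrE ?invr_ge0 //.
  by rewrite mulr_ge0 ?invr_ge0 ?ler0n // sumr_ge0 // => f _;
    apply: prodr_ge0 => v _; rewrite invr_ge0.
rewrite -[leRHS]mul1r; apply: ler_wpM2r; first by rewrite invr_ge0.
exact: sum_prod_options_le1.
Qed.

End SequentialCounting.

(** * Random orders of the vertices *)

Section RandomOrder.
Variable V : finType.

(** Orders are permutations followed by a fixed enumeration, so that transpositions act on them. *)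
Definition rank_of (p : {perm V}) (v : V) : nat := enum_rank (p v).

Lemma rank_of_inj p : injective (rank_of p).
Proof. by move=> u v /val_inj/enum_rank_inj/perm_inj. Qed.

Definition all_before (p : {perm V}) (S : seq V) v : bool :=
  all (fun u => rank_of p u < rank_of p v) S.

(** By symmetry each entry of [v :: S] comes last in equally many orders: composing with [tperm u v]
    exchanges the roles of [u] and [v]. *)
Lemma sum_all_before (v : V) (S : seq V) : uniq (v :: S) ->
  (size S).+1 * \sum_p all_before p S v = #|{perm V}|.
Proof.
move=> uS; pose T := v :: S.
pose last_in (p : {perm V}) u := all (fun x => rank_of p x <= rank_of p u) T.
have last_v p : all_before p S v = last_in p v.
  rewrite /last_in /= leqnn /=; apply: eq_in_all => u uS'.
  rewrite ltn_neqAle (inj_eq (@rank_of_inj p)).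
  by case: eqP uS' uS => [->|] //= ->.
have sum_last p : \sum_(u <- T) last_in p u = 1.
  have [u uT umax] : exists2 u, u \in T & last_in p u.
    have vT : v \in T by rewrite mem_head.
    have [u uT umax] := arg_maxnP (rank_of p) vT.
    by exists u => //; apply/allP => x; apply: umax.
  rewrite (bigD1_seq u) //= umax big1_seq ?addn0 // => x /andP[xu xT].
  apply/eqP; rewrite eqb0; apply: contra xu => /allP/(_ u uT) xmax.
  move/allP/(_ x xT): umax => umax.
  by rewrite -(inj_eq (@rank_of_inj p)) eqn_leq umax.
have swap u : u \in T -> \sum_p (last_in p u : nat) = \sum_p last_in p v.
  move=> uT; rewrite (reindex_inj (mulgI (tperm u v))) /=.
  apply: eq_bigr => p _; congr (nat_of_bool _).
  have rankE x : rank_of (tperm u v * p)%g x = rank_of p (tperm u v x).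
    by rewrite /rank_of permM.
  have tT x : x \in T -> tperm u v x \in T.
    by case: tpermP => // _ _; rewrite mem_head.
  apply/allP/allP => pmax x xT; last by rewrite !rankE tpermL pmax ?tT.
  by have := pmax _ (tT x xT); rewrite !rankE tpermL tpermK.
have <- : \sum_(u <- T) \sum_p (last_in p u : nat) = #|{perm V}|.
  rewrite exchange_big /= (eq_bigr (fun=> 1)) => [|p _]; last exact: sum_last.
  by rewrite sum_nat_const muln1; apply: eq_card => p.
rewrite [RHS]big_seq (eq_bigr _ swap) -big_seq big_const_seq
   count_predT iter_addn_0 mulnC.
by congr (_ * _); apply: eq_bigr => p _; rewrite last_v.
Qed.

Lemma prod_options_bound (v y1 y2 z1 z2 : V) (N : {perm V} -> nat) :
    uniq [:: v; y1; y2; z1; z2] ->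
    (forall p, N p <= if all_before p [:: z1; z2] v then 1
       else 1 + ~~ all_before p [:: y1] v + ~~ all_before p [:: y2] v) ->
  (\prod_p N p) ^ 30 <= (3 ^ 9 * 2 ^ 7) ^ #|{perm V}|.
Proof.
move=> uniqT leN.
pose b S p := all_before p S v.
(* [A] and [B] indicate the orders in which the bound on [N] is 3 and 2. *)
pose A p : nat := [&& ~~ b [:: z1; z2] p, ~~ b [:: y1] p & ~~ b [:: y2] p].
pose B p : nat := ~~ b [:: z1; z2] p && (b [:: y1] p (+) b [:: y2] p).
have leN' p : N p <= 3 ^ A p * 2 ^ B p.
  apply: leq_trans (leN p) _; rewrite /A /B /b.
  by do 3!case: all_before.
pose E S := \sum_p (b S p : nat).
have EE S : uniq (v :: S) -> (size S).+1 * E S = #|{perm V}|.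
  exact: sum_all_before.
have maskE S : (size (mask S [:: y1; y2; z1; z2])).+1 * E (mask S [:: y1; y2; z1; z2])
    = #|{perm V}|.
  by apply: EE; exact: (mask_uniq uniqT (true :: S)).
have := (maskE [:: true], maskE [:: false; true], maskE [:: true; true],
  maskE [:: false; false; true; true], maskE [:: true; false; true; true],
  maskE [:: false; true; true; true], maskE [:: true; true; true; true]).
rewrite /=.
set n := #|_|.
move=> [[[[[[e1 e2] e12] ez] e1z] e2z] e12z].
(* Inclusion-exclusion reduces A and B to the events of sum_all_before. *)
have sumA : \sum_p A p + E [:: y1] + E [:: y2] + E [:: z1; z2]
      + E [:: y1; y2; z1; z2]
    = n + E [:: y1; y2] + E [:: y1; z1; z2] + E [:: y2; z1; z2].
  have -> : n = \sum_(p : {perm V}) 1 by rewrite sum_nat_const muln1; apply: eq_card.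
  rewrite /E -!big_split /=; apply: eq_bigr => p _.
  rewrite /A /b /all_before /= !andbT.
  by do 4!case: (rank_of p _ < _).
have sumB : \sum_p B p + 2 * E [:: y1; y2] + E [:: y1; z1; z2]
      + E [:: y2; z1; z2]
    = E [:: y1] + E [:: y2] + 2 * E [:: y1; y2; z1; z2].
  rewrite /E !big_distrr -!big_split /=; apply: eq_bigr => p _.
  rewrite /B /b /all_before /= !andbT.
  by do 4!case: (rank_of p _ < _).
(* As [E S] is [n / (size S + 1)], the averages are 1 + 1/3 + 2/4 - 1 - 1/3 - 1/5 = 9/30 for [A] and
   1 + 2/5 - 2/3 - 2/4 = 7/30 for [B]. *)
have A30 : 30 * \sum_p A p = 9 * n by lia.
have B30 : 30 * \sum_p B p = 7 * n by lia.
apply: (@leq_trans ((\prod_p (3 ^ A p * 2 ^ B p)) ^ 30)).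
  by rewrite leq_exp2r //; apply: leq_prod.
rewrite big_split /= -!expn_sum [X in _ <= X]expnMn expnMn -!expnM.
by rewrite (mulnC _ 30) A30 (mulnC _ 30) B30.
Qed.

End RandomOrder.

(** * Pairs of perfect matchings as cycle covers *)

Section MatchingPairs.
Variables (V : finType) (e : rel V).
Hypotheses (e_sym : symmetric e) (e_irr : irreflexive e).

Definition involutions : {set {ffun V -> V}} :=
  [set m : {ffun V -> V} | [forall v, (m (m v) == v) && e v (m v)]].

(** An edge traversed back and forth counts as a cycle. Finite functions are used instead of
    permutations so that [options] applies. *)
Definition cycle_covers : {set {ffun V -> V}} :=
  [set s : {ffun V -> V} | injectiveb s && [forall v, e v (s v)]].

Lemma involutionsP (m : {ffun V -> V}) :
  reflect (involutive m /\ forall v, e v (m v)) (m \in involutions).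
Proof.
rewrite inE; apply: (iffP forallP) => [mP|[mK me] v]; last by rewrite mK eqxx me.
by split=> v; have /andP[/eqP] := mP v.
Qed.

Lemma cycle_coversP (s : {ffun V -> V}) :
  reflect (injective s /\ forall v, e v (s v)) (s \in cycle_covers).
Proof.
by rewrite inE; apply: (iffP andP) => -[/injectiveP ? /forallP ?].
Qed.

Lemma perfmat_le_involutions : perfmat e <= #|involutions|.
Proof.
pose match_of (m : {ffun V -> V}) := [set [set v; m v]%SET | v in V]%SET.
apply: leq_trans (leq_imset_card match_of _).
apply/subset_leq_card/fintype.subsetP => M.
rewrite inE => /andP[/fintype.subsetP Me /forallP M1].
pose mate v w :=
  e v w && [forall f, ((f \in M) && (v \in f)) == (f == [set v; w]%SET)].
have mate_ex v : exists w, mate v w.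
  have /cards1P[f fP] := M1 v.
  have fE g : (g \in M) && (v \in g) = (g == f).
    by move/setP/(_ g): fP; rewrite !inE.
  have /andP[fM vf] : (f \in M) && (v \in f) by rewrite fE.
  have := Me f fM; rewrite inE => /existsP[x /existsP[y /andP[exy /eqP fxy]]].
  move: vf fE; rewrite {}fxy !inE => /orP[] /eqP -> fE.
    by exists y; rewrite /mate exy; apply/forallP => g; rewrite fE.
  by exists x; rewrite /mate e_sym exy; apply/forallP => g; rewrite fE finset.setUC.
pose m := [ffun v => xchoose (mate_ex v)].
have me v : e v (m v) by rewrite ffunE; have /andP[] := xchooseP (mate_ex v).
have mM v f : (f \in M) && (v \in f) = (f == [set v; m v]%SET).
  by rewrite ffunE; have /andP[_ /forallP/(_ f)/eqP] := xchooseP (mate_ex v).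
have vM v : [set v; m v]%SET \in M.
  by have := mM v [set v; m v]%SET; rewrite eqxx => /andP[].
have mK v : m (m v) = v.
  have := mM (m v) [set v; m v]%SET; rewrite vM !inE eqxx orbT => /esym/eqP/setP/(_ v).
  rewrite !inE eqxx => /esym/orP[] /eqP // vm.
  by have := me v; rewrite -vm e_irr.
apply/imsetP; exists m; first by apply/involutionsP.
apply/setP => f; apply/idP/imsetP => [fM|[v _ ->]] //.
have := Me f fM; rewrite inE => /existsP[x /existsP[y /andP[exy /eqP fxy]]].
by exists x => //; apply/eqP; rewrite -mM fM fxy !inE eqxx.
Qed.

(* Which of two matchings a cycle cover s takes at v. The cycle through v is  *)
(* even and s * s has two orbits on it, the two classes of its bipartition;   *)
(* s takes the first matching on the class that comes first.                  *)
Definition first_class (s : {perm V}) v : bool :=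
  enum_rank (porbit (s * s)%g v) < enum_rank (porbit (s * s)%g (s v)).

Definition matching_pair (s : {perm V}) : {ffun V -> V} * {ffun V -> V} :=
  ([ffun v => if first_class s v then s v else (s^-1)%g v],
   [ffun v => if first_class s v then (s^-1)%g v else s v]).

(** The union of two matchings splits into alternating even cycles and shared edges; following [m1]
    from one class of the bipartition and [m2] from the other orients all of them. *)
Lemma cycle_cover_of_pair (m1 m2 : {ffun V -> V}) :
    m1 \in involutions -> m2 \in involutions ->
  exists s : {perm V}, (forall v, e v (s v)) /\ matching_pair s = (m1, m2).
Proof.
move=> /involutionsP[m1K e1] /involutionsP[m2K e2].
have m1F v : m1 v <> v by move=> vm; have := e1 v; rewrite vm e_irr.
have m2F v : m2 v <> v by move=> vm; have := e2 v; rewrite vm e_irr.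
(* [p] moves two steps along an alternating cycle, so its orbits are the bipartition classes. *)
pose p := (perm (can_inj m2K) * perm (can_inj m1K))%g.
have pE v : p v = m1 (m2 v) by rewrite permM !permE.
have pVE v : (p^-1)%g v = m2 (m1 v) 
  by apply: (@perm_inj _ p); rewrite permKV pE m2K m1K.
have porb v : porbit p (p v) = porbit p v.
  by apply/eqP; rewrite eq_porbit_mem; have := mem_porbit p 1 v; rewrite expg1.
have orb12 v : porbit p (m1 v) = porbit p (m2 v) by rewrite -(porb (m2 v)) pE m2K.
(* Descent by two: if [m1 v] is the [i.+2]-th iterate of [p] at [v], then [m1 (p v)] is the [i]-th
   iterate at [p v]. *)
have orb_m1 v : porbit p (m1 v) != porbit p v.
  rewrite eq_porbit_mem; apply/negP => /porbitP[i].
  elim/ltn_ind: i v => -[|[|i]] IH v.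
  - by rewrite expg0 perm1 => /m1F.
  - by rewrite expg1 pE => /(can_inj m1K)/esym/m2F.
  rewrite expgSr permM pE => /(can_inj m1K)/(canLR m2K) vE.
  have m1p : m1 (p v) = m2 v by rewrite pE m1K.
  by apply: (IH i _ (p v)); rewrite // m1p vE expgS permM.
pose c v := enum_rank (porbit p v) < enum_rank (porbit p (m1 v)).
have c1 v : c (m1 v) = ~~ c v.
  rewrite /c m1K -leqNgt ltn_neqAle andbC.
  case: leqP => //= _; apply/negP => /eqP/val_inj/enum_rank_inj vE.
  by have := orb_m1 v; rewrite vE eqxx.
have c2 v : c (m2 v) = ~~ c v.
  rewrite -c1 /c -orb12; congr (_ < enum_rank _).
  by rewrite m1K -(porb v) pE.
pose f v := if c v then m1 v else m2 v.
(* Both [m1] and [m2] exchange the classes, so vertices of different classes have different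
   images. *)
have f_inj : injective f.
  move=> x y; rewrite /f; case cx: (c x); case cy: (c y) => xy.
  - exact: (can_inj m1K).
  - by have := c2 y; rewrite -xy c1 cx cy.
  - by have := c1 y; rewrite -xy c2 cx cy.
  - exact: (can_inj m2K).
pose s := perm f_inj.
have sE v : s v = if c v then m1 v else m2 v by rewrite permE.
have orb_s v : porbit p (s v) = porbit p (m1 v) by rewrite sE; case: ifP.
have ssE v : (s * s)%g v = if c v then (p^-1)%g v else p v.
  by rewrite permM !sE pE pVE; case cv: (c v); rewrite ?c1 ?c2 cv.
have css v : c ((s * s)%g v) = c v.
  by rewrite ssE pE pVE; case: ifP => cv; rewrite ?(c1, c2) cv.
(* On each class [s * s] is [p] or its inverse. It thus has the orbits of [p], and [s] alone
   determines [c]. *)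
have orb_ss v : porbit (s * s)%g v = porbit p v.
  have ssX i : ((s * s) ^+ i)%g v = ((if c v then p^-1 else p) ^+ i)%g v
      /\ c (((s * s) ^+ i)%g v) = c v.
    elim: i => [|i [IH1 IH2]]; first by rewrite !expg0 perm1.
    have stepE (q : {perm V}) : (q ^+ i.+1)%g v = q ((q ^+ i)%g v).
      by rewrite expgSr permM.
    by rewrite !stepE css IH2 ssE IH2 IH1; case: (c v).
  have -> : porbit p v = porbit (if c v then p^-1 else p)%g v.
    by case: ifP => // _; rewrite porbitV.
  by apply/setP => w; apply/porbitP/porbitP => -[i ->]; exists i; have [] := ssX i.
have fcE v : first_class s v = c v by rewrite /first_class !orb_ss orb_s.
exists s; split=> [v|]; first by rewrite sE; case: ifP.
by congr (_, _); apply/ffunP => v; rewrite ffunE fcE; case cv: (c v);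
  rewrite ?sE ?cv //; apply: (@perm_inj _ s); rewrite permKV sE ?c1 ?c2 cv /= ?m1K ?m2K.
Qed.

Lemma sqr_perfmat_le_cycle_covers : perfmat e ^ 2 <= #|cycle_covers|.
Proof.
apply: (@leq_trans (#|involutions| ^ 2)).
  by rewrite leq_exp2r // perfmat_le_involutions.
pose P := [set s : {perm V} | [forall v, e v (s v)]].
apply: (@leq_trans #|P|).
  rewrite -mulnn -cardsX; apply: leq_trans (leq_imset_card matching_pair _).
  apply/subset_leq_card/fintype.subsetP => -[m1 m2]; rewrite !inE => /andP[m1P m2P].
  have [||s [es <-]] := @cycle_cover_of_pair m1 m2; rewrite ?inE //.
  by apply: imset_f; rewrite inE; apply/forallP.
rewrite -(card_imset _ val_inj); apply/subset_leq_card/fintype.subsetP => _ /imsetP[s + ->].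
rewrite inE => /forallP es; apply/cycle_coversP.
by split=> [|v]; [apply/injectiveP; exact: (valP s) | rewrite -[val s v]/(pval s v) pvalE].
Qed.

End MatchingPairs.

(** * Cubic graphs without 4-cycles *)

Section CubicNo4Cycle.
Variables (V : finType) (e : rel V).
Hypotheses (e_sym : symmetric e) (e_irr : irreflexive e).
Hypotheses (e_cubic : cubic e) (e_no4 : no_cycle e 4).

Lemma cubic_neighbours v a : e v a ->
  exists b c, uniq [:: a; b; c] /\ forall w, e v w = (w \in [:: a; b; c]).
Proof.
move=> eva; have := e_cubic v; rewrite (cardsD1 a) inE eva => -[]
  /eqP/cards2P[b [c [bc bcE]]].
have bcP w : (w != a) && e v w = (w == b) || (w == c).
  by have /setP/(_ w) := bcE; rewrite !inE.
exists b, c; split=> [|w].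
  have := bcP b; have := bcP c; rewrite !eqxx orbT /= !inE => /andP[ca _] /andP[ba _].
  by rewrite negb_or eq_sym ba eq_sym ca bc.
by rewrite !inE -bcP; case: eqP => [->|].
Qed.

(** Otherwise [x], [a], [y], [b] would form a 4-cycle. *)
Lemma common_neighbour_eq x y a b : a != b ->
  e x a -> e x b -> e y a -> e y b -> x = y.
Proof.
move=> ab xa xb ya yb; apply/eqP; apply: contraT => xy.
have ne u w : e u w -> u != w by apply: contraTneq => ->; rewrite e_irr.
case: (@e_no4 [:: x; a; y; b]) => //; rewrite /ucycle /= !inE !negb_or.
rewrite xa yb (e_sym a) ya (e_sym b) xb xy ab (ne _ _ xa) (ne _ _ xb) (ne _ _ yb).
by rewrite eq_sym (ne _ _ ya).
Qed.

Local Notation covers := (cycle_covers e).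

Lemma prod_options_cubic (s : {ffun V -> V}) v : s \in covers ->
  (\prod_p #|options (rank_of p) covers v s|) ^ 30 <= (3 ^ 9 * 2 ^ 7) ^ #|{perm V}|.
Proof.
move=> sP; have [s_inj es] := cycle_coversP _ _ sP.
have [w1 [w2 [uw wP]]] := cubic_neighbours (es v).
have vs : e (s v) v by rewrite e_sym.
have [z1 [z2 [uz zP]]] := cubic_neighbours vs.
pose y1 := invF s_inj w1; pose y2 := invF s_inj w2.
have sy1 : s y1 = w1 by exact: f_invF.
have sy2 : s y2 = w2 by exact: f_invF.
have [sw1 sw2 w12] : [/\ s v != w1, s v != w2 & w1 != w2].
  by move: uw; rewrite /= !inE negb_or => /and3P[/andP[-> ->] -> _].
have [vz1 vz2 z12] : [/\ v != z1, v != z2 & z1 != z2].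
  by move: uz; rewrite /= !inE negb_or => /and3P[/andP[-> ->] -> _].
(* If [y = z], then [v] and [y] share the two neighbours [s v] and [s y], which forces [v = y]. *)
have yz y z : s v != s y -> e v (s y) -> e (s v) z -> v != z -> y != z.
  move=> vy evy ez; apply: contraNneq => yz; apply/eqP.
  by apply: common_neighbour_eq vy _ _ _ _; rewrite // -?yz // e_sym yz.
have ew1 : e v w1 by rewrite wP !inE eqxx orbT.
have ew2 : e v w2 by rewrite wP !inE eqxx !orbT.
have ez1 : e (s v) z1 by rewrite zP !inE eqxx orbT.
have ez2 : e (s v) z2 by rewrite zP !inE eqxx !orbT.
have [yz11 yz12 yz21 yz22] : [/\ y1 != z1, y1 != z2, y2 != z1 & y2 != z2].
  by split; apply: yz; rewrite ?sy1 ?sy2.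
apply: (@prod_options_bound V v y1 y2 z1 z2).
  rewrite /= !inE !negb_or vz1 vz2 z12 -(inj_eq s_inj v) sy1 sw1 -(inj_eq s_inj v) sy2 sw2.
  by rewrite -(inj_eq s_inj y1) sy1 sy2 w12 yz11 yz12 yz21 yz22.
move=> p; set N := #|_|.
have tP t : t \in agree_below (rank_of p) covers (rank_of p v) s ->
    [/\ injective t, forall u, e u (t u)
      & forall u, rank_of p u < rank_of p v -> t u = s u].
  by case/agree_belowP=> /cycle_coversP[].
case: ifPn => [|_].
  (* The preimage of [s v] under [t] is one of its neighbours [v], [z1], [z2]; the last two are
     already sent elsewhere. *)
  rewrite /all_before /= andbT => /andP[z1v z2v].
  apply: (@leq_trans #|[set s v]|%SET); last by rewrite cards1.
  apply/subset_leq_card/fintype.subsetP => _ /imsetP[t /tP[t_inj et ts] ->].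
  set u := invF t_inj (s v); have tu : t u = s v by exact: f_invF.
  have := et u; rewrite tu e_sym zP !inE => /or3P[] /eqP uE; first by rewrite -{1}uE tu.
    by move: tu; rewrite uE (ts z1) // => /s_inj zv; rewrite zv eqxx in vz1.
  by move: tu; rewrite uE (ts z2) // => /s_inj zv; rewrite zv eqxx in vz2.
have early (t : {ffun V -> V}) y : t \in agree_below (rank_of p) covers (rank_of p v) s ->
    s v != s y -> all_before p [:: y] v -> t v != s y.
  case/tP=> t_inj _ ts vy; rewrite /all_before /= andbT => /ts <-.
  by rewrite (inj_eq t_inj); apply: contraNneq vy => ->.
(* If [y1] comes before [v], then [w1] is already taken as its image; likewise for [y2] and [w2]. *)
pose cand := [:: s v] ++ nseq (~~ all_before p [:: y1] v) w1
  ++ nseq (~~ all_before p [:: y2] v) w2.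
apply: (@leq_trans (size cand)); last by rewrite !size_cat !size_nseq addnA.
apply: leq_trans (card_size cand).
apply/subset_leq_card/fintype.subsetP => _ /imsetP[t tA ->].
have [_ et _] := tP t tA.
have := et v; rewrite wP !inE !mem_cat !mem_nseq.
case/or3P=> /eqP tv; rewrite tv ?eqxx ?orbT //.
  case: (boolP (all_before p [:: y1] v)) => [/(early t y1 tA)|]; rewrite ?orbT //.
  by rewrite sy1 tv eqxx => /(_ sw1).
case: (boolP (all_before p [:: y2] v)) => [/(early t y2 tA)|]; rewrite ?orbT //.
by rewrite sy2 tv eqxx => /(_ sw2).
Qed.

(** Multiply [card_le_prod_options] over all orders and exchange the products: [prod_options_cubic]
    bounds the factor of each cover and vertex, and the common exponent [N * m] cancels. *)
Lemma card_cycle_covers_le : #|covers| ^ 30 <= (3 ^ 9 * 2 ^ 7) ^ #|V|.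
Proof.
set N := #|covers|; set C := 3 ^ 9 * 2 ^ 7.
have C_gt0 : 0 < C by rewrite muln_gt0 !expn_gt0.
have [->|N_gt0] := posnP N; first by rewrite exp0n // expn_gt0 C_gt0.
set m := #|{perm V}|.
have m_gt0 : 0 < m by apply/card_gt0P; exists 1%g.
have le1 : (N ^ N) ^ m <=
    \prod_(s in covers) \prod_v \prod_p #|options (rank_of p) covers v s|.
  under eq_bigr do rewrite exchange_big.
  rewrite exchange_big /= -[m in leqLHS](eq_card (fun=> erefl)) -prod_nat_const.
  by apply: leq_prod => p _; apply: card_le_prod_options; apply: rank_of_inj.
have : ((N ^ N) ^ m) ^ 30 <= ((C ^ m) ^ #|V|) ^ N.
  apply: (@leq_trans (\prod_(s in covers) \prod_(v : V) C ^ m)); last first.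
    by rewrite !prod_nat_const.
  have := le1; rewrite -(@leq_exp2r _ _ 30) // => /leq_trans; apply.
  have expM := big_morph (expn^~ 30) (fun x y => expnMn x y 30) (exp1n 30).
  rewrite expM; apply: leq_prod => s sP; rewrite expM; apply: leq_prod => v _.
  exact: prod_options_cubic.
have -> : ((N ^ N) ^ m) ^ 30 = (N ^ 30) ^ (N * m).
  by rewrite -!expnM; congr (_ ^ _); lia.
have -> : ((C ^ m) ^ #|V|) ^ N = (C ^ #|V|) ^ (N * m).
  by rewrite -!expnM; congr (_ ^ _); lia.
by rewrite leq_exp2r // muln_gt0 N_gt0.
Qed.

Lemma perfmat_pow12_le : perfmat e ^ 12 <= 20 ^ #|V|.
Proof.
(* The fifth power turns the left side into [(perfmat e ^ 2) ^ 30], and [3 ^ 9 * 2 ^ 7] = 2519424 is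
   below [20 ^ 5] = 3200000. *)
rewrite -(@leq_exp2r _ _ 5) // -!expnM.
have -> : 12 * 5 = 2 * 30 by [].
rewrite expnM; apply: leq_trans (_ : #|covers| ^ 30 <= _).
  by rewrite leq_exp2r // sqr_perfmat_le_cycle_covers.
apply: leq_trans card_cycle_covers_le _.
have leq_expl a b n : a <= b -> a ^ n <= b ^ n.
  by case: n => // n; rewrite leq_exp2r.
by rewrite (mulnC _ 5) (expnM 20); apply: leq_expl; lia.
Qed.

End CubicNo4Cycle.

(** * The bounds with real exponents *)

Local Open Scope ring_scope.

Theorem theorem6p7 (R : realType) (V : finType) (e : rel V)
    (e_sym : symmetric e) (e_irr : irreflexive e)
    (D : plane_drawing R e) (k : nat) (r : nat -> R)
    (e_semicircular : semicircular D k r)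
    (e_cubic : cubic e) (e_no3 : no_cycle e 3) (e_no4 : no_cycle e 4) :
  let n := #|V| in
  let n1 := #|disk_vertices D r| in
  let n0 := #|inner_vertices D r| in
  ((0 < n0)%N ->
     (perfmat e)%:R <= 20 `^ ((n%:R - n1%:R) / 12) * 3 `^ (n1%:R / 4) :> R) /\
  (circular D k r -> (perfmat e)%:R <= 20 `^ (n%:R / 12) :> R).
Proof.
have le20 : (perfmat e)%:R <= 20 `^ (#|V|%:R / 12) :> R.
  rewrite -(@ler_pXn2r _ 12) ?nnegrE ?powR_ge0 // -[leRHS]powR_mulrn ?powR_ge0 //.
  rewrite -powRrM mulfVK ?pnatr_eq0 // powR_mulrn // -!natrX ler_nat.
  exact: perfmat_pow12_le.
split=> // _; apply: le_trans le20 _.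
have -> : #|V|%:R / 12 = (#|V|%:R - #|disk_vertices D r|%:R) / 12
    + #|disk_vertices D r|%:R / 12 :> R by lra.
rewrite powRD; last by rewrite pnatr_eq0 implybT.
apply: ler_wpM2l; first exact: powR_ge0.
(* The power of 3 becomes a power of 27 with exponent [n1 / 12], and 20 <= 27. *)
have -> : #|disk_vertices D r|%:R / 4 = 3 * (#|disk_vertices D r|%:R / 12) :> R by lra.
rewrite [leRHS]powRrM powR_mulrn //.
by apply: (@ge0_ler_powR R _ _ 20 (3 ^+ 3)); rewrite ?nnegrE ?divr_ge0 //; lra.
Qed.
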